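(* Let $\{\omega_n:n\in\mathbb{N}_0\}$ and $\{\tilde\omega_n:n\in\mathbb{N}_0\}$ be the wavelet packets (defined in the context) associated with a pair of biorthogonal scaling functions $\omega_0=\varphi$ and $\tilde\omega_0=\tilde\varphi$ and associated biorthogonal wavelets. Then $$\langle\omega_n(\cdot),\tilde\omega_n(\cdot-u(k))\rangle=\delta_{0,k}\quad\text{for all }k\in\mathbb{N}_0,\ n\in\mathbb{N}_0.$$
   Context: $K$ is a local field of positive characteristic $p$ with ring of integers $\mathfrak{D}=\{|x|\le1\}$, prime ideal $\mathfrak{B}=\mathfrak{p}\mathfrak{D}$ ($\mathfrak{p}$ a prime element), $q=|\mathfrak{D}/\mathfrak{B}|=p^c$, Haar measure normalized with $\mathfrak{D}$ of measure $1$. Choose $\zeta_0=1,\zeta_1,\dots,\zeta_{c-1}\in\mathfrak{D}$ with $|\zeta_j|=1$ whose images form a basis of $\mathfrak{D}/\mathfrak{B}\cong GF(q)$ over $GF(p)$; for $0\le n<q$, $n=a_0+a_1p+\dots+a_{c-1}p^{c-1}$ ($0\le a_k<p$), put $u(n)=(a_0+a_1\zeta_1+\dots+a_{c-1}\zeta_{c-1})\mathfrak{p}^{-1}$, and for $n=b_0+b_1q+\dots+b_sq^s$ ($0\le b_k<q$), $u(n)=u(b_0)+u(b_1)\mathfrak{p}^{-1}+\dots+u(b_s)\mathfrak{p}^{-s}$. $\chi$ is a character of $(K,+)$ trivial on $\mathfrak{D}$, non-trivial on $\mathfrak{B}^{-1}$, $\chi_k(x)=\chi(u(k)x)$; $\hat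 f(\xi)=\int_Kf(x)\overline{\chi(\xi x)}dx$. Let $\varphi,\tilde\varphi\in L^2(K)$ and $\psi_\ell,\tilde\psi_\ell\in L^2(K)$ ($1\le\ell\le q-1$) satisfy $\varphi(x)=\sqrt q\sum_{k\in\mathbb{N}_0}a_k^0\varphi(\mathfrak{p}^{-1}x-u(k))$, $\psi_\ell(x)=\sqrt q\sum_ka_k^\ell\varphi(\mathfrak{p}^{-1}x-u(k))$, and the same with tildes (coefficients $\tilde a_k^s$), all coefficient sequences in $\ell^2(\mathbb{N}_0)$; masks $m_s(\xi)=\frac1{\sqrt q}\sum_ka_k^s\overline{\chi_k(\xi)}$, $\tilde m_s$ analogously ($0\le s\le q-1$). $\varphi$ is the scaling function of a multiresolution analysis of $L^2(K)$ and $\{\psi_\ell(\cdot-u(k))\}$ is a Riesz basis of a direct complement $W_0$ of $V_0$ in $V_1$. Biorthogonality: for all $k\in\mathbb{N}_0$, $1\le\ell,\ell'\le q-1$: $\langle\varphi,\tilde\varphi(\cdot-u(k))\rangle=\delta_{0,k}$, $\langle\varphi,\tilde\psi_\ell(\cdot-u(k))\rangle=0$, $\langle\tilde\varphi,\psi_\ell(\cdot-u(k))\rangle=0$, $\langle\psi_\ell,\tilde\psi_{\ell'}(\cdot-u(k))\rangle=\delta_{\ell,\ell'}\delta_{0,k}$. Wavelet packets: $\omega_0=\varphi$, $\tilde\omega_0=\tilde\varphi$, and for $n=qr+s$ with $r\in\mathbb{N}_0$, $0\le s\le q-1$: $\omega_n(x)=\sqrt q\sum_{k\in\mathbb{N}_0}a_k^s\omega_r(\mathfrak{p}^{-1}x-u(k))$,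 $\tilde\omega_n(x)=\sqrt q\sum_k\tilde a_k^s\tilde\omega_r(\mathfrak{p}^{-1}x-u(k))$ (so $\omega_s=\psi_s$, $\tilde\omega_s=\tilde\psi_s$ for $1\le s\le q-1$). *)

(* Defs.v *)
From HB Require Import structures.
From mathcomp Require Import all_boot all_order all_algebra.
From mathcomp Require Import all_classical all_reals all_analysis.
From mathcomp Require Import complex.

Set Implicit Arguments.
Unset Strict Implicit.
Unset Printing Implicit Defensive.

Import Order.TTheory GRing.Theory Num.Theory.
Local Open Scope classical_set_scope.
Local Open Scope ring_scope.

(* The local field K, viewed as a pointed type (base point 0), so that it can
   carry the sigma-algebra generated by its (closed) balls. *)
Definition Kpt (K : fieldType) : Type := K.
HB.instance Definition _ (K : fieldType) := Choice.on (Kpt K).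
HB.instance Definition _ (K : fieldType) := isPointed.Build (Kpt K) (0 : K).

Definition ball_sets (R : realType) (K : fieldType) (ab : K -> R)
  : set (set (Kpt K)) :=
  [set B | exists (c : K) (r : R), B = [set x : K | ab (x - c) <= r]].

(* K with the Borel sigma-algebra (generated by the balls) *)
Definition KM (R : realType) (K : fieldType) (ab : K -> R) :=
  g_sigma_algebraType (ball_sets ab).

Section LocalField.
Variables (R : realType) (K : fieldType).

(* (K, |.|) is a local field of characteristic p with prime element pr,
   residue field of order q = p^c, and zeta_0 = 1, zeta_1, ..., zeta_{c-1}
   units whose images form a basis of D/B over GF(p). |.| is the normalized
   (modulus) absolute value: |pr| = q^-1 and |K^*| = q^Z. *)
Record local_field (p c : nat) (ab : K -> R) (pr : K) (zeta : 'I_c -> K)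
  : Prop := {
  lf_prime : prime p;
  lf_char : p \in [pchar K];
  lf_c : (0 < c)%N;
  lf_ab_ge0 : forall x, 0 <= ab x;
  lf_ab_eq0 : forall x, ab x = 0 <-> x = 0;
  lf_abM : forall x y, ab (x * y) = ab x * ab y;
  lf_ab_ultra : forall x y, ab (x + y) <= Num.max (ab x) (ab y);
  lf_value_group : forall x, x != 0 -> exists z : int, ab x = ((p ^ c)%N%:R : R) ^ z;
  lf_prime_elt : ab pr = ((p ^ c)%N%:R : R)^-1;
  lf_complete : forall s : nat -> K,
     (forall e : R, 0 < e -> exists N, forall m n, (N <= m)%N -> (N <= n)%N ->
         ab (s m - s n) < e) ->
     exists l : K, forall e : R, 0 < e -> exists N, forall n, (N <= n)%N ->
         ab (s n - l) < e;
  lf_zeta0 : forall j : 'I_c, val j = 0%N -> zeta j = 1;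
  lf_zeta_unit : forall j, ab (zeta j) = 1;
  (* the images of zeta_j in D/B form a basis of D/B over GF(p) *)
  lf_residue_basis : forall x, ab x <= 1 ->
     exists! a : {ffun 'I_c -> 'I_p}, ab (x - \sum_(j < c) (a j : nat)%:R * zeta j) < 1
}.

Definition digit (b j n : nat) : nat := (n %/ b ^ j) %% b.

(* u(n) for 0 <= n < q *)
Definition u0 (p c : nat) (pr : K) (zeta : 'I_c -> K) (n : nat) : K :=
  (\sum_(j < c) (digit p j n)%:R * zeta j) * pr^-1.

(* u(n) = u(b_0) + u(b_1) pr^-1 + ... + u(b_s) pr^-s, b_k base-q digits of n
   (digits of index > n vanish) *)
Definition u (p c : nat) (pr : K) (zeta : 'I_c -> K) (n : nat) : K :=
  \sum_(k < n.+1) u0 p pr zeta (digit (p ^ c) k n) * pr ^- k.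

Variables (ab : K -> R).
Local Notation KMT := (KM ab).

Record haar (mu : {measure set KMT -> \bar R}) : Prop := {
  haar_transl : forall (a : K) (E : set KMT), measurable E ->
      mu [set (x + a : K) | x in E] = mu E;
  haar_D : mu [set x : KMT | ab x <= 1] = 1%E
}.

Variable mu : {measure set KMT -> \bar R}.

Definition zerof : K -> R[i] := fun=> 0.

Definition csq (z : R[i]) : R := (complex.Re z) ^+ 2 + (complex.Im z) ^+ 2.

Definition L2 (f : K -> R[i]) : Prop :=
  [/\ measurable_fun setT (fun x : KMT => complex.Re (f x)),
      measurable_fun setT (fun x : KMT => complex.Im (f x)) &
      (\int[mu]_x (csq (f x))%:E < +oo)%E].

Definition dist2 (f g : K -> R[i]) : \bar R :=
  \int[mu]_x (csq (f x - g x))%:E.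

Definition inner (f g : K -> R[i]) : R[i] :=
  Complex (fine (\int[mu]_x (complex.Re (f x * conjc (g x)))%:E))
          (fine (\int[mu]_x (complex.Im (f x * conjc (g x)))%:E)).

Definition L2_lim (s : nat -> K -> R[i]) (f : K -> R[i]) : Prop :=
  (fun N => dist2 (s N) f) @ \oo --> 0%E.

Definition translate (g : K -> R[i]) (t : K) : K -> R[i] := fun x => g (x - t).

Definition closed_subspace (V : (K -> R[i]) -> Prop) : Prop :=
  [/\ forall f, V f -> L2 f,
      V zerof,
      forall f g, V f -> V g -> V (fun x => f x + g x),
      forall (a : R[i]) f, V f -> V (fun x => a * f x) &
      forall (s : nat -> K -> R[i]) f, (forall n, V (s n)) -> L2 f -> L2_lim s f -> V f].

Definition riesz_basis (I : countType) (e : I -> K -> R[i]) (V : (K -> R[i]) -> Prop)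
  : Prop :=
  (exists A B : R, [/\ 0 < A, 0 < B &
     forall (S : seq I) (a : I -> R[i]), uniq S ->
       let F := fun x => \sum_(i <- S) a i * e i x in
       ((A * \sum_(i <- S) csq (a i))%:E <= dist2 F zerof)%E /\
       (dist2 F zerof <= (B * \sum_(i <- S) csq (a i))%:E)%E]) /\
  (forall f, V f <-> (L2 f /\ exists (S : nat -> seq I) (a : nat -> I -> R[i]),
       L2_lim (fun N x => \sum_(i <- S N) a N i * e i x) f)).

Variables (p c : nat) (pr : K) (zeta : 'I_c -> K).
Local Notation uu := (u p pr zeta).

Definition MRA (V : int -> (K -> R[i]) -> Prop) (phi : K -> R[i]) : Prop :=
  [/\ forall j, closed_subspace (V j),
      forall j f, V j f -> V (j + 1) f,
      forall f, L2 f -> forall e : R, 0 < e ->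
         exists j g, V j g /\ (dist2 f g < e%:E)%E,
      (forall f, (forall j, V j f) -> dist2 f zerof = 0%E) /\
      (forall j f, V j f <-> V (j + 1) (fun x => f (pr^-1 * x))) &
      V 0 phi /\ riesz_basis (fun k : nat => translate phi (uu k)) (V 0)].

Definition refine_partial (a : nat -> R[i]) (g : K -> R[i]) (N : nat) : K -> R[i] :=
  fun x => Complex (Num.sqrt ((p ^ c)%N%:R : R)) 0 * \sum_(k < N) a k * g (pr^-1 * x - uu k).

Definition refinement (a : nat -> R[i]) (g' g : K -> R[i]) : Prop :=
  L2_lim (refine_partial a g') g.

Definition l2seq (a : nat -> R[i]) : Prop :=
  (\sum_(0 <= k <oo) (csq (a k))%:E < +oo)%E.

End LocalField.

(* Main.v *)
Require Import Defs.
From HB Require Import structures.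
From mathcomp Require Import all_boot all_order all_algebra.
From mathcomp Require Import all_classical all_reals all_analysis.
From mathcomp Require Import measurable_realfun complex ring lra.
Import Order.TTheory GRing.Theory Num.Theory.
Import numFieldNormedType.Exports.
Local Open Scope classical_set_scope.
Local Open Scope ring_scope.

Set Implicit Arguments.
Unset Strict Implicit.
Unset Printing Implicit Defensive.

(** The translations u(k) form a subgroup of K stable under multiplication by
    pr^-1 (digits are added in characteristic p), and x |-> pr^-1 x - v
    multiplies the Haar measure by q^-1.  Expanding a partial sum of
    refinements bilinearly therefore gives
      <R_N a f, T_u(m) (R_N ta ft)>
        = sum_(k, l < N) a_k conj(ta_l) <f, ft(. - (pr^-1 u(m) + u(l) - u(k)))>,
    in which the last argument is again some u(j): the pairing depends on
    (f, ft) only through the numbers <f, ft(. - u(j))>.  In the limit the same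
    holds for <F, Ft(. - u(m))> when F, Ft are the refinements of f, ft.  If
    n = q r + s, then by induction (omega_r, tilde omega_r) and (phi, tilde phi)
    have the same numbers, so omega_n inherits its pairings from psi_s
    (from phi if s = 0), whose biorthogonality is assumed. *)

(** * Digits in a base b *)

Lemma digit0n b j : digit b j 0 = 0%N.
Proof. by rewrite /digit div0n mod0n. Qed.

Lemma digit_recl b d n : (d < b)%N -> digit b 0 (d + b * n) = d.
Proof. by move=> db; rewrite /digit expn0 divn1 addnC mulnC modnMDl modn_small. Qed.

Lemma digit_recr b d n j : (d < b)%N -> digit b j.+1 (d + b * n) = digit b j n.
Proof.
move=> db; have b0 : (0 < b)%N by exact: leq_ltn_trans db.
by rewrite /digit expnS divnMA addnC mulnC divnMDl// (divn_small db) addn0.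
Qed.

Lemma digit_small b j n : (1 < b)%N -> (n <= j)%N -> digit b j n = 0%N.
Proof.
move=> b1 nj; rewrite /digit divn_small ?mod0n//.
by apply: leq_ltn_trans nj _; exact: ltn_expl.
Qed.

(** The number is assembled by Horner's rule, lowest digit first; [u0_add] needs it to realise a
    list of digit sums reduced mod p. *)
Lemma exists_digits b c (e : nat -> nat) : (0 < b)%N ->
  (forall j, (e j < b)%N) ->
  exists2 n, (n < b ^ c)%N & forall j, (j < c)%N -> digit b j n = e j.
Proof.
move=> b0; elim: c e => [|c IH] e eb; first by exists 0%N.
have [n nb en] := IH (e \o succn) (fun j => eb j.+1).
exists (e 0 + b * n)%N => [|[|j] jc].
- rewrite expnS; apply: (@leq_trans (b * n.+1)).
    by rewrite mulnS ltn_add2r.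
  by rewrite leq_mul2l nb orbT.
- exact: digit_recl.
- by rewrite digit_recr// en.
Qed.

(** * The group of translations *)

Section Translations.
Context {K : fieldType} (p c : nat) (pr : K) (zeta : 'I_c -> K).
Hypotheses (p_pr : prime p) (pK : p \in [pchar K]) (c_gt0 : (0 < c)%N).
Local Notation q := (p ^ c)%N.
Local Notation uu := (u p pr zeta).
Local Notation uu0 := (u0 p pr zeta).

Let p_gt0 : (0 < p)%N := prime_gt0 p_pr.
Let q_gt0 : (0 < q)%N. Proof. by rewrite expn_gt0 p_gt0. Qed.

Lemma residue_order_gt1 : (1 < q)%N.
Proof. by rewrite -(expn0 p) ltn_exp2l ?prime_gt1. Qed.

Let natr_modp n : (n %% p)%:R = n%:R :> K.
Proof.
rewrite [in RHS](divn_eq n p) natrD natrM.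
by have /andP[_ /eqP->] := pK; rewrite mulr0 add0r.
Qed.

Lemma u0_0 : uu0 0 = 0.
Proof. by rewrite /u0 big1 ?mul0r// => j _; rewrite digit0n mul0r. Qed.

Lemma u_0 : uu 0 = 0.
Proof. by rewrite /u big_ord1 digit0n u0_0 mul0r. Qed.

(** The range of the sum in [u] depends on n. Enlarging it adds only zero digits, because n < q^n,
    and lets different indices share one range. *)
Lemma u_widen n m : (n <= m)%N ->
  uu n = \sum_(k < m.+1) uu0 (digit q k n) * pr ^- k.
Proof.
move=> nm; rewrite /u (big_ord_widen m.+1 (fun k => uu0 (digit q k n) * pr ^- k))//.
rewrite big_mkcond; apply: eq_bigr => k _; case: ltnP => // nk.
by rewrite digit_small ?u0_0 ?mul0r ?residue_order_gt1// ltnW.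
Qed.

(** Splitting off the lowest base-q digit turns [u] into a recursion, on which the closure
    properties below rest. *)
Lemma u_rec b n : (b < q)%N -> uu (b + q * n) = uu0 b + pr^-1 * uu n.
Proof.
move=> bq; rewrite (@u_widen _ (b + q * n).+1)// big_ord_recl/= expr0 invr1 mulr1.
rewrite digit_recl//; congr (_ + _).
rewrite (@u_widen n (b + q * n)); last first.
  by rewrite (leq_trans _ (leq_addl _ _))// leq_pmull.
rewrite mulr_sumr; apply: eq_bigr => k _.
by rewrite /bump/= add1n digit_recr// exprS invfM mulrCA.
Qed.

Lemma u_divn n : uu n = uu0 (n %% q) + pr^-1 * uu (n %/ q).
Proof. by rewrite -u_rec ?ltn_pmod// addnC mulnC -divn_eq. Qed.

(** Since p = 0 in K, base-p digits may be added mod p, without carries. *)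
Lemma u0_add b d : exists2 e, (e < q)%N & uu0 b + uu0 d = uu0 e.
Proof.
have [|e eq eE] := @exists_digits p c
    (fun j => (digit p j b + digit p j d) %% p)%N p_gt0.
  by move=> j; exact: ltn_pmod.
exists e => //; rewrite /u0 -mulrDl -big_split/=; congr (_ * _).
by apply: eq_bigr => j _; rewrite eE// natr_modp natrD mulrDl.
Qed.

(** By [u0_add] the lowest base-q digits combine without a carry, so induction applies to the
    quotients by q. *)
Lemma u_add n m : exists k, uu n + uu m = uu k.
Proof.
elim/ltn_ind: n m => -[_ m|n IH m]; first by exists m; rewrite u_0 add0r.
have [k kE] := IH _ (ltn_Pdiv residue_order_gt1 (ltn0Sn n)) (m %/ q)%N.
have [e eq eE] := u0_add (n.+1 %% q) (m %% q).
exists (e + q * k)%N; rewrite u_rec// -eE -kE.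
by rewrite [in LHS]u_divn [uu m]u_divn mulrDr addrACA.
Qed.

(** In characteristic p one has -x = (p - 1) x, so closure under addition suffices. *)
Lemma u_opp n : exists k, - uu n = uu k.
Proof.
have -> : - uu n = uu n *+ p.-1.
  apply/eqP; rewrite eq_sym -addr_eq0 -mulrSr prednK//.
  by rewrite -mulr_natr; have /andP[_ /eqP->] := pK; rewrite mulr0.
elim: p.-1 => [|m [k kE]]; first by exists 0%N; rewrite u_0 mulr0n.
have [l lE] := u_add k n.
by exists l; rewrite mulrSr kE.
Qed.

(** Multiplication by [pr^-1] puts a zero digit in front, so the index is multiplied by q. *)
Lemma u_dilate n : exists k, pr^-1 * uu n = uu k.
Proof. by exists (q * n)%N; rewrite -[(q * n)%N]add0n u_rec// u0_0 add0r. Qed.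

End Translations.

(** * Haar measure under affine maps *)

Section Haar.
Context {R : realType} {K : fieldType} {p c : nat} {ab : K -> R} {pr : K}
  {zeta : 'I_c -> K}.
Hypothesis HK : local_field p ab pr zeta.
Local Notation KMT := (KM ab).
Local Notation q := (p ^ c)%N.

Let q_gt1 : (1 < q)%N := residue_order_gt1 (lf_prime HK) (lf_c HK).

Let q_gt1R : 1 < q%:R :> R. Proof. by rewrite ltr1n. Qed.

Let q_gt0R : 0 < q%:R :> R. Proof. exact: lt_trans q_gt1R. Qed.

Lemma ab_neq0 x : x != 0 -> ab x != 0.
Proof. by apply: contraNneq => /(lf_ab_eq0 HK)->. Qed.

Lemma ab_gt0 x : x != 0 -> 0 < ab x.
Proof. by move=> x0; rewrite lt0r ab_neq0//= (lf_ab_ge0 HK). Qed.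

Lemma ab0 : ab 0 = 0. Proof. exact/(lf_ab_eq0 HK). Qed.

Lemma ab1 : ab 1 = 1.
Proof.
apply: (mulfI (ab_neq0 (oner_neq0 K))).
by rewrite -(lf_abM HK) !mulr1.
Qed.

Lemma abN x : ab (- x) = ab x.
Proof.
rewrite -mulN1r (lf_abM HK); suff -> : ab (-1) = 1 by rewrite mul1r.
apply/eqP; rewrite -(@pexpr_eq1 _ _ 2) ?(lf_ab_ge0 HK)//.
by rewrite expr2 -(lf_abM HK) mulrNN mulr1 ab1.
Qed.

Lemma abV x : ab x^-1 = (ab x)^-1.
Proof.
have [->|x0] := eqVneq x 0; first by rewrite invr0 ab0 invr0.
apply: (mulfI (ab_neq0 x0)).
by rewrite -(lf_abM HK) !divff ?ab1 ?ab_neq0.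
Qed.

Lemma prime_elt_neq0 : pr != 0.
Proof.
apply/negP => /eqP pr0; have := lf_prime_elt HK; rewrite pr0 ab0.
by move/esym/eqP; rewrite invr_eq0 gt_eqF.
Qed.

Lemma ab_prX n : ab (pr ^- n) = q%:R ^+ n.
Proof.
rewrite abV; elim: n => [|n IH]; first by rewrite !expr0 ab1 invr1.
by rewrite !exprS (lf_abM HK) invfM IH (lf_prime_elt HK) invrK.
Qed.

Lemma ab_prZ (z : int) : ab (pr ^ z) = q%:R ^ (- z).
Proof.
case: z => n; last by rewrite NegzE opprK -exprnN ab_prX.
by rewrite -exprnN -exprnP -[pr ^+ n]invrK abV ab_prX.
Qed.

(** Nonzero values of [ab] are integer powers of q, so a closed ball sees only the largest such
    power not exceeding its radius; z is the floor of log_q r. *)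
Lemma radius_in_value_group (r : R) : 0 < r ->
  exists2 t, t != 0 & forall x, (ab x <= r) = (ab x <= ab t).
Proof.
move=> r0; pose z := Num.floor (ln r / ln (q%:R : R)).
exists (pr ^ (- z)) => [|x]; first by rewrite expfz_neq0 ?prime_elt_neq0.
rewrite ab_prZ opprK.
have [->|x0] := eqVneq x 0; first by rewrite ab0 ltW// exprz_ge0// ltW.
have [w ->] := lf_value_group HK x0.
rewrite ler_eXz2l// floor_ge_int ler_pdivlMr ?ln_gt0// -ln_powR.
by rewrite powR_intmul ?(ltW q_gt0R)// ler_ln ?posrE// exprz_gt0.
Qed.

(** * Closed balls of the ultrametric *)

Definition cball (x : K) (r : R) : set KMT := [set y : K | ab (y - x) <= r].

Lemma cball_ball_sets x r : ball_sets ab (cball x r).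
Proof. by exists x, r. Qed.

Lemma measurable_cball x r : measurable (cball x r).
Proof. by apply: sub_sigma_algebra; exact: cball_ball_sets. Qed.

Lemma cball_lt0 x r : r < 0 -> cball x r = set0.
Proof.
move=> r0; rewrite -subset0 => y; rewrite /cball/= => /le_lt_trans/(_ r0).
by rewrite ltNge (lf_ab_ge0 HK).
Qed.

Lemma subset_cball x y r s : r <= s -> ab (x - y) <= s -> cball x r `<=` cball y s.
Proof.
move=> rs xys z; rewrite /cball/= => zr; rewrite -(subrKA x) (le_trans (lf_ab_ultra HK _ _))//.
by rewrite ge_max (le_trans zr rs).
Qed.

(** Two ultrametric balls are nested or disjoint. The empty intersection still counts as a ball, of
    radius -1. This makes the balls a pi-system, as uniqueness of measures requires. *)
Lemma ball_sets_setI : setI_closed (ball_sets ab).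
Proof.
move=> _ _ [x [r ->]] [y [s ->]]; rewrite -!/(cball _ _).
wlog rs : x y r s / r <= s => [H|].
  have [/H|/ltW/H] := leP r s; first exact.
  by rewrite setIC; exact.
have [xys|xys] := boolP (ab (x - y) <= s).
  rewrite setIidl; first exact: cball_ball_sets.
  exact: subset_cball.
suff -> : cball x r `&` cball y s = cball 0 (-1) by exact: cball_ball_sets.
rewrite [cball 0 _]cball_lt0 ?ltrN10// -subset0 => z; rewrite /cball/= => -[zr zs].
case/negP: xys; rewrite -(subrKA z) (le_trans (lf_ab_ultra HK _ _))//.
by rewrite ge_max zs andbT -abN opprB (le_trans zr rs).
Qed.

Lemma affine_preimage_cball s v x r : s != 0 ->
  (fun y : KMT => s * y - v : KMT) @^-1` cball x r = cball ((x + v) / s) (r / ab s).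
Proof.
move=> s0; apply/seteqP; split => y /=; rewrite /cball/= ler_pdivlMr ?ab_gt0//;
  by rewrite -(lf_abM HK) mulrBl divfK// [y * s]mulrC opprD addrA addrAC.
Qed.

Lemma measurable_affine s v : s != 0 ->
  measurable_fun setT (fun y : KMT => s * y - v : KMT).
Proof.
move=> s0; apply: (@measurability _ _ KMT KMT setT _ (ball_sets ab)) => //.
move=> _ [_ [x [r ->]] <-]; rewrite setTI -/(cball _ _) affine_preimage_cball//.
exact: measurable_cball.
Qed.

(** * Measure of balls, and scaling of the Haar measure *)

Context {mu : {measure set KMT -> \bar R}}.
Hypothesis Hmu : haar mu.
Local Open Scope ereal_scope.

(** The factor 1 presents the translation as an affine map s y - v, so that the lemmas on affine
    maps cover it. *)
Lemma haar_translate (v : K) (E : set KMT) : measurable E ->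
  mu ((fun y : KMT => 1 * y - v : KMT)%R @^-1` E) = mu E.
Proof.
move=> mE; rewrite -[RHS](haar_transl Hmu v)//; congr (mu _).
apply/seteqP; split => y /=; rewrite ?mul1r.
  by move=> Ey; exists (y - v)%R => //; rewrite subrK.
by case=> z Ez <-; rewrite addrK.
Qed.

Lemma haar_cball x r : mu (cball x r) = mu (cball 0 r).
Proof.
rewrite -(haar_translate x (measurable_cball 0 r)) affine_preimage_cball ?oner_neq0//.
by rewrite add0r ab1 !divr1.
Qed.

(** These are the q representatives of D/B provided by [lf_residue_basis]. *)
Let residue_rep (f : {ffun 'I_c -> 'I_p}) : K :=
  (\sum_(j < c) (f j : nat)%:R * zeta j)%R.

Let ab_residue_rep f : (ab (residue_rep f) <= 1)%R.
Proof.
apply: (@big_ind _ (fun x => ab x <= 1)%R).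
- by rewrite ab0.
- by move=> a b a1 b1; rewrite (le_trans (lf_ab_ultra HK _ _))// ge_max a1.
- move=> j _; rewrite (lf_abM HK) (lf_zeta_unit HK) mulr1.
  elim: (nat_of_ord _) => [|n IH]; first by rewrite ab0.
  by rewrite mulrS (le_trans (lf_ab_ultra HK _ _))// ge_max ab1 lexx.
Qed.

(** The ball of radius |t| is the disjoint union of q translates of the ball of radius |t|/q, one
    for each residue class of y/t. *)
Lemma haar_cball_scale (t : K) : (t != 0)%R ->
  mu (cball 0 (ab t)) = (q%:R)%:E * mu (cball 0 (ab t / q%:R)%R).
Proof.
move=> t0; pose F f := cball (t * residue_rep f)%R (ab t / q%:R)%R.
(* No value of [ab] lies strictly between q^-1 and 1, so being at most q^-1 is the same as being
   less than 1. *)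
have abtP y (f : {ffun 'I_c -> 'I_p}) :
    F f y <-> (ab (y / t - residue_rep f) < 1)%R.
  rewrite /F /cball/=.
  have -> : (y - t * residue_rep f = t * (y / t - residue_rep f))%R.
    by rewrite mulrBr mulrCA divff ?mulr1.
  rewrite (lf_abM HK) ler_pM2l ?ab_gt0//.
  set d := (y / t - _)%R; have [->|d0] := eqVneq d 0%R.
    by rewrite ab0 ltr01 invr_ge0 ltW.
  have [z ->] := lf_value_group HK d0.
  rewrite -[X in (_ <= X)%R]exprN1 ler_eXz2l// -[X in (_ < X)%R](expr0z (q%:R : R)).
  by rewrite ltr_eXz2l// -[X in _ <-> (z < X)%R]addr0 -(subrr 1%R) addrC -lezD1 lerBrDr.
have tE y : (ab (y - 0) <= ab t)%R = (ab (y / t) <= 1)%R.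
  by rewrite subr0 (lf_abM HK) abV ler_pdivrMr ?ab_gt0// mul1r.
have Fsub y f : (ab (y / t - residue_rep f) < 1)%R -> (ab (y / t) <= 1)%R.
  move=> yf; rewrite -(subrK (residue_rep f) (y / t)%R).
  by rewrite (le_trans (lf_ab_ultra HK _ _))// ge_max (ltW yf)/= ab_residue_rep.
have -> : cball 0 (ab t) = \bigcup_(f in [set` enum {ffun 'I_c -> 'I_p}]) F f.
  apply/seteqP; split => y.
    rewrite /cball/= tE => /(lf_residue_basis HK)[f [fy _]].
    by exists f; [rewrite /= mem_enum|exact/abtP].
  by move=> [f _ /abtP/Fsub]; rewrite /cball/= tE.
rewrite measure_fin_bigcup//=; last first.
- by move=> f _; exact: measurable_cball.
(* Disjointness is the uniqueness of the residue digits of y/t. *)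
- move=> f g _ _ [y [yf yg]].
  have yt : (ab (y / t) <= 1)%R.
    by apply: (Fsub _ f); exact/abtP.
  have [h [_ h_uniq]] := lf_residue_basis HK yt.
  by rewrite -(h_uniq f) -1?(h_uniq g)//; exact/abtP.
rewrite -fsbig_seq ?enum_uniq//=.
under eq_bigr do rewrite haar_cball.
(* The summands are equal, and there are p^c functions from ['I_c] to ['I_p]. *)
rewrite big_const_seq count_predT iter_addr addr0 -cardT card_ffun !card_ord.
by rewrite mule_natl.
Qed.

Lemma haar_cball_expr n : mu (cball 0 (q%:R ^+ n)%R) = (q%:R ^+ n)%:E.
Proof.
elim: n => [|n IH].
  rewrite expr0 -(haar_D Hmu); congr (mu _).
  by apply/seteqP; split => y; rewrite /cball/= subr0.
rewrite -ab_prX haar_cball_scale; last by rewrite invr_neq0 ?expf_neq0 ?prime_elt_neq0.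
by rewrite ab_prX exprSr mulfK ?gt_eqF// IH EFinM muleC.
Qed.

(** The product form avoids division by an extended real whose finiteness is not yet known. *)
Lemma haar_cball_exprN n : (q%:R ^+ n)%:E * mu (cball 0 (q%:R ^- n)%R) = 1.
Proof.
elim: n => [|n IH].
  by rewrite expr0 mul1e invr1 -[X in cball _ X](expr0 (q%:R : R)) haar_cball_expr expr0.
have abX : ab (pr ^+ n) = (q%:R ^- n)%R by rewrite -ab_prX abV invrK.
rewrite -IH -abX haar_cball_scale ?expf_neq0 ?prime_elt_neq0//.
by rewrite abX exprSr invfM [(_^-1 * _)%R]mulrC EFinM muleA.
Qed.

(** The point 0 lies in every ball of radius q^-n, so its measure is at most q^-n for all n. *)
Lemma haar_cball00 : mu (cball 0 0%R) = 0.
Proof.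
have qle n : (q%:R ^+ n)%:E * mu (cball 0 0%R) <= 1.
  rewrite -(haar_cball_exprN n) lee_pmul2l// ?lte_fin ?exprn_gt0//.
  apply: le_measure; rewrite ?inE; [exact: measurable_cball..|].
  by apply: subset_cball; rewrite ?subrr ?ab0 invr_ge0 exprn_ge0// ltW.
have := qle 0%N; rewrite expr0 mul1e => m1.
have m0 : 0 <= mu (cball 0 0%R) by exact: measure_ge0.
have mfin : mu (cball 0 0%R) \is a fin_num.
  by rewrite ge0_fin_numE// (le_lt_trans m1) ?ltry.
move: m0 qle; rewrite -(fineK mfin); set r := fine _; rewrite lee_fin => r0 qle.
congr (_%:E); apply/eqP; apply: contraT => rn0; have {rn0}r_gt0 : (0 < r)%R by rewrite lt0r rn0.
(* With this n one has r^-1 < n <= q^n, against q^n r <= 1. *)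
pose n := Num.bound r^-1.
have := qle n; rewrite -EFinM lee_fin -ler_pdivlMr// mul1r leNgt => /negP[].
rewrite (lt_le_trans (archi_boundP _)) ?invr_ge0//.
by rewrite -natrX ler_nat ltnW// ltn_expl.
Qed.

(** All real radii are covered because the generating balls have arbitrary real radii: negative ones
    give empty balls, positive ones reduce to the value group, and radius 0 gives a null set. *)
Lemma haar_cball_div r : mu (cball 0 r) = (q%:R)%:E * mu (cball 0 (r / q%:R)%R).
Proof.
have [r0|r0|->] := ltgtP r 0%R.
- by rewrite !cball_lt0 ?measure0 ?mule0// pmulr_llt0 ?invr_gt0.
- have [t t0 tE] := radius_in_value_group r0.
  have -> : cball 0 r = cball 0 (ab t).
    by apply/seteqP; split => y; rewrite /cball/= tE.
  (* Multiplying y by [pr^-1] turns the bound r/q into the bound r, to which [tE] applies. *)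
  have -> : cball 0 (r / q%:R)%R = cball 0 (ab t / q%:R)%R.
    apply/seteqP; split => y; rewrite /cball/= !ler_pdivlMr//;
    by rewrite -[(q%:R)%R]invrK -(lf_prime_elt HK) -abV -(lf_abM HK) tE.
  exact: haar_cball_scale.
- by rewrite mul0r haar_cball00 mule0.
Qed.

(** The pushforward of mu and q^-1 mu agree on balls, a generating pi-system, and are finite on the
    balls of radius q^n, which exhaust K. *)
Lemma haar_dilate (v : K) (E : set KMT) : measurable E ->
  mu ((fun y : KMT => pr^-1 * y - v : KMT)%R @^-1` E) = (q%:R^-1)%:E * mu E.
Proof.
have prV0 : (pr^-1 != 0)%R by rewrite invr_neq0// prime_elt_neq0.
have qV0 : (0 <= q%:R^-1 :> R)%R by rewrite invr_ge0 ltW.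
pose k : {nonneg R} := NngNum qV0.
pose A (y : KMT) : KMT := (pr^-1 * y - v)%R.
have mA : measurable_fun setT A := measurable_affine v prV0.
have [m1 m1E] : exists m : {measure set KMT -> \bar R}, m = pushforward mu A :> (set KMT -> \bar R).
  by unshelve eexists; [refine (pushforward mu A : {measure set KMT -> \bar R}) | ].
pose m2 : {measure set KMT -> \bar R} := mscale k mu.
move=> mE; rewrite -[LHS]/(pushforward mu A E) -m1E -[RHS]/(m2 E).
apply: (@measure_unique _ R KMT (ball_sets ab) (fun n => cball 0 (q%:R ^+ n)%R)
  _ _ _ _ m1 m2) => //.
- exact: ball_sets_setI.
- by move=> n; exact: cball_ball_sets.
- rewrite -subTset => y _.
  have y0 := lf_ab_ge0 HK y.
  exists (Num.bound (ab y)) => //; rewrite /cball/= subr0.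
  rewrite (le_trans (ltW (archi_boundP y0)))//.
  by rewrite -natrX ler_nat ltnW// ltn_expl.
- move=> _ [x [r ->]]; rewrite -/(cball x r) m1E /pushforward/=.
  rewrite affine_preimage_cball// !haar_cball abV (lf_prime_elt HK) invrK.
  by rewrite /mscale/= [in RHS]haar_cball [in RHS]haar_cball_div muleA -EFinM mulVf ?mul1e// gt_eqF.
(* The preimage is a ball of radius q^n/q; after recentring at 0 it sits inside the ball of radius
   q^n, of measure q^n. *)
- move=> n; rewrite m1E /pushforward/= affine_preimage_cball// haar_cball.
  rewrite abV (lf_prime_elt HK) invrK.
  rewrite (@le_lt_trans _ _ (mu (cball 0 (q%:R ^+ n)%R)))//; last first.
    by rewrite haar_cball_expr ltry.
  apply: le_measure; rewrite ?inE; [exact: measurable_cball..|].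
  apply: subset_cball; rewrite ?subrr ?ab0 ?exprn_ge0// ?(ltW q_gt0R)//.
  by rewrite ler_pdivrMr// ler_peMr ?exprn_ge0// ltW.
Qed.

End Haar.

(** * The sesquilinear form on square-integrable functions *)

Section ComplexParts.
Context {R : realType}.
Implicit Types (z w : R[i]) (b : bool).

(** The boolean index lets a single argument treat the real and imaginary integrals that make up
    [inner]. *)
Definition part b z : R := if b then complex.Re z else complex.Im z.

Lemma partD b z w : part b (z + w) = part b z + part b w.
Proof. by case: b z w => -[? ?] [? ?]. Qed.

Lemma part_inj z w : (forall b, part b z = part b w) -> z = w.
Proof. by case: z w => [x y] [x' y'] H; move: (H true) (H false) => /= -> ->. Qed.

Lemma part_mulconj b z w : part b (z * conjc w) =
  if b then complex.Re z * complex.Re w + complex.Im z * complex.Im w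
  else complex.Im z * complex.Re w - complex.Re z * complex.Im w.
Proof. by case: b z w => -[x y] [x' y'] /=; ring. Qed.

Lemma part_mul b z w : part b (z * w) =
  complex.Re z * part b w + (if b then - complex.Im z else complex.Im z) * part (~~ b) w.
Proof. by case: b z w => -[x y] [x' y'] /=; ring. Qed.

Lemma conjcD z w : conjc (z + w) = conjc z + conjc w.
Proof. by case: z w => [? ?] [? ?]; rewrite /= opprD. Qed.

Lemma conjcM z w : conjc (z * w) = conjc z * conjc w.
Proof. by case: z w => [x y] [x' y']; apply: part_inj; case => /=; ring. Qed.

Lemma csq_ge0 z : 0 <= csq z.
Proof. by rewrite addr_ge0 ?sqr_ge0. Qed.

Lemma csqM z w : csq (z * w) = csq z * csq w.
Proof. by case: z w => [x y] [x' y']; rewrite /csq/=; ring. Qed.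

Lemma csqD_le z w : csq (z + w) <= 2 * csq z + 2 * csq w.
Proof.
case: z w => [x y] [x' y']; rewrite /csq/=.
by have := sqr_ge0 (x - x'); have := sqr_ge0 (y - y'); nra.
Qed.

(** Weighted arithmetic-geometric mean: expand t^-1 (t|x| - |y|)^2 >= 0. *)
Lemma normM_le_sqr (t x y : R) : 0 < t -> `|x * y| <= t * x ^+ 2 + t^-1 * y ^+ 2.
Proof.
move=> t0; have t1 : t * t^-1 = 1 by rewrite divff// gt_eqF.
have tV0 : 0 <= t^-1 by rewrite invr_ge0 ltW.
rewrite normrM -(real_normK (num_real x)) -(real_normK (num_real y)).
have x0 := normr_ge0 x; have y0 := normr_ge0 y.
have := mulr_ge0 tV0 (sqr_ge0 (t * `|x| - `|y|)).
have -> : t^-1 * (t * `|x| - `|y|) ^+ 2 =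
  (t * t^-1) * (t * `|x| ^+ 2) - 2 * (t * t^-1) * (`|x| * `|y|) + t^-1 * `|y| ^+ 2 by ring.
by rewrite t1 mul1r mulr1; have := mulr_ge0 x0 y0; lra.
Qed.

Lemma part_mulconj_le b (t : R) z w : 0 < t ->
  `|part b (z * conjc w)| <= t * csq z + t^-1 * csq w.
Proof.
move=> t0; rewrite part_mulconj /csq; case: b.
  rewrite (le_trans (ler_normD _ _))// !mulrDr addrACA.
  by apply: lerD; exact: normM_le_sqr.
rewrite (le_trans (ler_normB _ _))// !mulrDr [X in _ <= X + _]addrC addrACA.
by apply: lerD; exact: normM_le_sqr.
Qed.

End ComplexParts.

(** * Square-integrable functions: linearity and continuity of the inner product *)

Section SquareIntegrable.
Context {R : realType} {K : fieldType} {ab : K -> R}.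
Context {mu : {measure set (KM ab) -> \bar R}}.
Local Notation KMT := (KM ab).
Implicit Types (f g h : K -> R[i]) (b : bool).

Definition cmeasurable f := forall b, measurable_fun setT (fun x : KMT => part b (f x)).

Lemma L2_cmeasurable f : L2 mu f -> cmeasurable f.
Proof. by case=> mr mi _ []. Qed.

Lemma cmeasurableD f g : cmeasurable f -> cmeasurable g ->
  cmeasurable (fun x => f x + g x).
Proof.
move=> mf mg b; under eq_fun do rewrite partD.
exact: measurable_funD.
Qed.

Lemma cmeasurableZ (w : R[i]) f : cmeasurable f -> cmeasurable (fun x => w * f x).
Proof.
move=> mf b; under eq_fun do rewrite part_mul.
by apply: measurable_funD; apply: measurable_funM.
Qed.

Lemma cmeasurable_mulconj f g : cmeasurable f -> cmeasurable g ->
  cmeasurable (fun x => f x * conjc (g x)).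
Proof.
move=> mf mg b; under eq_fun do rewrite part_mulconj.
have fr : measurable_fun setT (fun x : KMT => complex.Re (f x)) := mf true.
have fi : measurable_fun setT (fun x : KMT => complex.Im (f x)) := mf false.
have gr : measurable_fun setT (fun x : KMT => complex.Re (g x)) := mg true.
have gi : measurable_fun setT (fun x : KMT => complex.Im (g x)) := mg false.
by case: b => /=; [apply: measurable_funD|apply: measurable_funB];
  apply: measurable_funM.
Qed.

Lemma measurable_csq f : cmeasurable f -> measurable_fun setT (fun x : KMT => csq (f x)).
Proof.
move=> mf; apply: measurable_funD; apply: measurable_funX;
  [exact: (mf true)|exact: (mf false)].
Qed.

Lemma integrable_EFinZ (k : R) (h : KMT -> R) : mu.-integrable setT (EFin \o h) ->
  mu.-integrable setT (EFin \o (fun x => k * h x)).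
Proof.
move=> ih; rewrite (_ : _ \o _ = fun x => (k%:E * (h x)%:E)%E) //.
exact: integrableZl.
Qed.

Lemma integrable_EFinD (h h' : KMT -> R) :
  mu.-integrable setT (EFin \o h) -> mu.-integrable setT (EFin \o h') ->
  mu.-integrable setT (EFin \o (fun x => h x + h' x)).
Proof.
move=> ih ih'; rewrite (_ : _ \o _ = (EFin \o h) \+ (EFin \o h'))%E //.
exact: integrableD.
Qed.

(** This form brings the integrability calculus to bear on [L2]. *)
Lemma L2P f : L2 mu f <->
  cmeasurable f /\ mu.-integrable setT (EFin \o (fun x : KMT => csq (f x))).
Proof.
split=> [[mr mi fin]|[mf /integrableP[_ fin]]].
  have mf : cmeasurable f by case.
  split=> //; apply/integrableP; split; first by apply/measurable_EFinP; exact: measurable_csq.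
  by under eq_integral do rewrite /= ger0_norm ?csq_ge0//.
split; [exact: (mf true)|exact: (mf false)|].
by under eq_integral do rewrite -[csq _]ger0_norm ?csq_ge0//.
Qed.

Lemma L2D f g : L2 mu f -> L2 mu g -> L2 mu (fun x => f x + g x).
Proof.
move=> /L2P[mf nf] /L2P[mg ng]; apply/L2P; split; first exact: cmeasurableD.
apply: (@le_integrable _ KMT R mu setT measurableT _
    ((fun x : KMT => 2%:E * (csq (f x))%:E) \+ (fun x : KMT => 2%:E * (csq (g x))%:E))%E) => //.
- by apply/measurable_EFinP; apply: measurable_csq; exact: cmeasurableD.
- move=> x _; rewrite /= lee_fin !ger0_norm ?csqD_le ?csq_ge0//.
  by rewrite addr_ge0// mulr_ge0// csq_ge0.
- by apply: integrableD => //; exact: integrableZl.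
Qed.

Lemma L2Z (w : R[i]) f : L2 mu f -> L2 mu (fun x => w * f x).
Proof.
move=> /L2P[mf nf]; apply/L2P; split; first exact: cmeasurableZ.
rewrite (_ : _ \o _ = fun x : KMT => ((csq w)%:E * (csq (f x))%:E)%E); last first.
  by apply/funext => x /=; rewrite csqM.
exact: integrableZl.
Qed.

Lemma L2B f g : L2 mu f -> L2 mu g -> L2 mu (fun x => f x - g x).
Proof.
move=> Lf Lg; rewrite (_ : (fun _ => _) = fun x => f x + (-1) * g x).
  by apply: L2D => //; exact: L2Z.
by apply/funext => x; rewrite mulN1r.
Qed.

Lemma L2_0 : L2 mu (fun=> 0).
Proof.
apply/L2P; split; first by case; exact: measurable_cst.
rewrite (_ : _ \o _ = cst 0%E); first exact: integrable0.
by apply/funext => x /=; rewrite /csq/= expr0n addr0.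
Qed.

Lemma L2_sum N (F : nat -> K -> R[i]) : (forall k, L2 mu (F k)) ->
  L2 mu (fun x => \sum_(k < N) F k x).
Proof.
move=> LF; elim: N => [|N IH].
  by under eq_fun do rewrite big_ord0; exact: L2_0.
by under eq_fun do rewrite big_ord_recr/=; exact: L2D.
Qed.

Lemma part_inner b f g : part b (inner mu f g) = \int[mu]_x part b (f x * conjc (g x)).
Proof. by case: b. Qed.

(** The squared norm as a real number; an infinite integral would be read as 0, so the value is
    meaningful for f in [L2]. *)
Definition nrm2 f : R := \int[mu]_x csq (f x).

Lemma integrable_mulconj b f g : L2 mu f -> L2 mu g ->
  mu.-integrable setT (EFin \o (fun x : KMT => part b (f x * conjc (g x)))).
Proof.
move=> /L2P[mf nf] /L2P[mg ng].
apply: (@le_integrable _ KMT R mu setT measurableT _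
    ((fun x : KMT => (csq (f x))%:E) \+ (fun x : KMT => (csq (g x))%:E))%E) => //.
- by apply/measurable_EFinP; exact: cmeasurable_mulconj.
- move=> x _; rewrite /= lee_fin.
  rewrite (le_trans (part_mulconj_le b _ _ (@ltr01 R)))// invr1 !mul1r.
  exact: ler_norm.
- exact: integrableD.
Qed.

(** This stands in for Cauchy-Schwarz: the free t makes the weight of one factor as small as
    desired, at the expense of the other. *)
Lemma inner_le b (t : R) f g : 0 < t -> L2 mu f -> L2 mu g ->
  `|part b (inner mu f g)| <= t * nrm2 f + t^-1 * nrm2 g.
Proof.
move=> t0 Lf Lg; have /L2P[mf nf] := Lf; have /L2P[mg ng] := Lg.
have ifg := integrable_mulconj b Lf Lg.
have itf : mu.-integrable setT (EFin \o (fun x : KMT => t * csq (f x))).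
  exact: integrable_EFinZ.
have itg : mu.-integrable setT (EFin \o (fun x : KMT => t^-1 * csq (g x))).
  exact: integrable_EFinZ.
rewrite part_inner (le_trans (le_normr_Rintegral _ _))//.
rewrite -!RintegralZl// -RintegralD//; apply: le_Rintegral => //.
- exact: integrable_norm.
- exact: integrable_EFinD.
- by move=> x _; exact: part_mulconj_le.
Qed.

Lemma innerDl f g h : L2 mu f -> L2 mu g -> L2 mu h ->
  inner mu (fun x => f x + g x) h = inner mu f h + inner mu g h.
Proof.
move=> Lf Lg Lh; apply: part_inj => b; rewrite partD !part_inner.
rewrite -RintegralD//; try exact: integrable_mulconj.
by apply: eq_Rintegral => x _; rewrite mulrDl partD.
Qed.

Lemma innerZl (w : R[i]) f g : L2 mu f -> L2 mu g ->
  inner mu (fun x => w * f x) g = w * inner mu f g.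
Proof.
move=> Lf Lg; apply: part_inj => b; rewrite part_mul !part_inner.
have ifg b' := integrable_mulconj b' Lf Lg.
rewrite -!RintegralZl// -RintegralD//; try exact: integrable_EFinZ.
by apply: eq_Rintegral => x _; rewrite -mulrA part_mul.
Qed.

(** Conjugate symmetry transfers linearity from the first argument to the second. *)
Lemma inner_conj f g : L2 mu f -> L2 mu g -> inner mu g f = conjc (inner mu f g).
Proof.
move=> Lf Lg; apply: part_inj; case.
  rewrite -[RHS]/(part true (inner mu f g)) !part_inner.
  by apply: eq_Rintegral => x _; rewrite !part_mulconj; ring.
rewrite -[RHS]/(- part false (inner mu f g)) !part_inner -mulN1r -RintegralZl//.
  by apply: eq_Rintegral => x _; rewrite !part_mulconj; ring.
exact: integrable_mulconj.
Qed.

Lemma innerDr f g h : L2 mu f -> L2 mu g -> L2 mu h ->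
  inner mu h (fun x => f x + g x) = inner mu h f + inner mu h g.
Proof.
move=> Lf Lg Lh; rewrite inner_conj ?innerDl//; last exact: L2D.
by rewrite conjcD -!inner_conj.
Qed.

Lemma innerZr (w : R[i]) f g : L2 mu f -> L2 mu g ->
  inner mu f (fun x => w * g x) = conjc w * inner mu f g.
Proof.
move=> Lf Lg; rewrite inner_conj ?innerZl//; last exact: L2Z.
by rewrite conjcM -inner_conj.
Qed.

Lemma inner0l g : inner mu (fun=> 0) g = 0.
Proof.
apply: part_inj => b; rewrite part_inner (_ : (fun _ => _) = cst 0).
  by rewrite /Rintegral integral0; case: b.
by apply/funext => x; rewrite mul0r; case: b.
Qed.

Lemma inner_suml N (F : nat -> K -> R[i]) g : (forall k, L2 mu (F k)) -> L2 mu g ->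
  inner mu (fun x => \sum_(k < N) F k x) g = \sum_(k < N) inner mu (F k) g.
Proof.
move=> LF Lg; elim: N => [|N IH].
  by under eq_fun do rewrite big_ord0; rewrite big_ord0 inner0l.
under eq_fun do rewrite big_ord_recr/=.
by rewrite big_ord_recr/= innerDl ?IH//; exact: L2_sum.
Qed.

Lemma inner_sumr N (F : nat -> K -> R[i]) g : (forall k, L2 mu (F k)) -> L2 mu g ->
  inner mu g (fun x => \sum_(k < N) F k x) = \sum_(k < N) inner mu g (F k).
Proof.
move=> LF Lg; rewrite inner_conj ?inner_suml//; last exact: L2_sum.
rewrite (@big_morph _ _ (@conjc R) 0 +%R) ?conjc0//; last exact: conjcD.
by apply: eq_bigr => k _; rewrite -inner_conj.
Qed.

Lemma L2_lim_nrm2 (s : nat -> K -> R[i]) f : L2_lim mu s f ->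
  nrm2 (fun x => s n x - f x) @[n --> \oo] --> 0.
Proof. by move=> /fine_cvgP[_]. Qed.

Lemma inner_cvg b (s t : nat -> K -> R[i]) f g :
  (forall n, L2 mu (s n)) -> (forall n, L2 mu (t n)) -> L2 mu f -> L2 mu g ->
  L2_lim mu s f -> L2_lim mu t g ->
  part b (inner mu (s n) (t n)) @[n --> \oo] --> part b (inner mu f g).
Proof.
move=> Ls Lt Lf Lg /L2_lim_nrm2 sf /L2_lim_nrm2 tg.
have Ld n := L2B (Ls n) Lf; have Le n := L2B (Lt n) Lg.
have nrm2_ge0 h : 0 <= nrm2 h by apply: Rintegral_ge0 => x _; exact: csq_ge0.
apply/cvgrPdist_lt => e e0.
pose M := nrm2 f + nrm2 g + 1; have M0 : 0 < M by rewrite ltr_wpDl ?addr_ge0.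
(* The weights T^-1 and T give the fixed norms a total below T^-1 M = e/2, while the vanishing norms
   enter with factor 1 + T and are taken below e/2/(1 + T). The summand 1 in M keeps T positive. *)
pose T := 2 * M / e; have T0 : 0 < T by rewrite divr_gt0 ?mulr_gt0.
have T10 : 0 < 1 + T by rewrite addr_gt0.
have eT : 0 < e / 2 / (1 + T) by rewrite !divr_gt0.
have nde : nrm2 (fun x => s n x - f x) + nrm2 (fun x => t n x - g x)
    @[n --> \oo] --> (0 : R).
  by rewrite -[X in _ --> X]addr0; exact: cvgD.
have /cvgrPdist_lt/(_ _ eT) := nde; apply: filterS => n.
rewrite sub0r normrN => small.
(* Expand s_n = f + (s_n - f) and t_n = g + (t_n - g) bilinearly. *)
have -> : inner mu (s n) (t n) = inner mu f g + (inner mu f (fun x => t n x - g x)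
    + inner mu (fun x => s n x - f x) g
    + inner mu (fun x => s n x - f x) (fun x => t n x - g x)).
  rewrite -addrA -innerDr// addrA -innerDr//.
  rewrite (_ : (fun x => g x + (t n x - g x)) = t n); last first.
    by apply/funext => x; rewrite addrC subrK.
  rewrite -innerDl//; congr (inner mu _ _).
  by apply/funext => x; rewrite addrC subrK.
rewrite !partD opprD addrA subrr sub0r normrN.
rewrite (le_lt_trans (ler_normD _ _))//.
have V0 : 0 < T^-1 by rewrite invr_gt0.
have i1 := inner_le b V0 Lf (Le n).
have i2 := inner_le b T0 (Ld n) Lg.
have i3 := inner_le b ltr01 (Ld n) (Le n).
have VM : T^-1 * M = e / 2 by rewrite /T invfM invrK; field; rewrite ?gt_eqF.
have := le_lt_trans (ler_norm _) small; rewrite ltr_pdivlMr//.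
move: VM i1 i2 i3; rewrite invrK invr1 !mul1r /M !mulrDr mulr1.
set x := part b _; set y := part b _; set z := part b _.
have := ler_normD x y.
by nra.
Qed.
End SquareIntegrable.

(** * Change of variables *)

Section ChangeOfVariables.
Context {d : measure_display} {T : measurableType d} {R : realType}.
Context {mu : {measure set T -> \bar R}} {A : T -> T} {k : R}.
Hypotheses (mA : measurable_fun setT A) (k_gt0 : 0 < k).
Hypothesis muA : forall E, measurable E -> mu (A @^-1` E) = (k%:E * mu E)%E.
Local Open Scope ereal_scope.

(** The left side is the integral of f against the pushforward of mu, which is k mu by [muA]. *)
Let ge0_integral_scale (f : T -> \bar R) : measurable_fun setT f ->
  (forall x, 0 <= f x) -> \int[mu]_x f (A x) = k%:E * \int[mu]_x f x.
Proof.
move=> mf f0; have k0 : (0 <= k)%R by exact: ltW.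
rewrite -(ge0_integral_mscale mu measurableT (NngNum k0))//.
transitivity (\int[pushforward mu A]_x f x).
  by rewrite ge0_integral_pushforward.
by apply: eq_measure_integral => E mE _; exact: muA.
Qed.

(** Positive and negative parts scale separately. Their integrals may be infinite, and the positive
    real k distributes over the difference in each of these cases. *)
Lemma integral_scale (f : T -> \bar R) : measurable_fun setT f ->
  \int[mu]_x f (A x) = k%:E * \int[mu]_x f x.
Proof.
move=> mf; rewrite integralE [in RHS]integralE.
under eq_integral do rewrite (funepos_comp f).
under [X in _ - X]eq_integral do rewrite (funeneg_comp f).
rewrite !ge0_integral_scale//; [|exact: measurable_funeneg|exact: measurable_funepos].
have : 0 <= \int[mu]_x f^\+ x by exact: integral_ge0.
have : 0 <= \int[mu]_x f^\- x by exact: integral_ge0.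
case: (\int[mu]_x f^\+ x) (\int[mu]_x f^\- x) => [x| |] [y| |]//= _ _;
  rewrite ?gt0_muley ?gt0_muleNy ?lte_fin//.
exact: (congr1 EFin (esym (mulrBr k x y))).
Qed.

Lemma Rintegral_scale (f : T -> R) : measurable_fun setT f ->
  (\int[mu]_x f (A x) = k * \int[mu]_x f x)%R.
Proof.
move=> mf; rewrite /Rintegral (@integral_scale (EFin \o f))//; last exact/measurable_EFinP.
(* An infinite integral stays infinite after scaling by k, and [fine] sends both sides to 0. *)
by case: (\int[mu]_x _) => [x| |]//=; rewrite ?gt0_muley ?gt0_muleNy ?lte_fin ?mulr0.
Qed.

End ChangeOfVariables.

(** * Square-integrability, distance and inner product under a map scaling the measure *)

Section ScalingSquareIntegrable.
Context {R : realType} {K : fieldType} {ab : K -> R}.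
Context {mu : {measure set (KM ab) -> \bar R}}.
Local Notation KMT := (KM ab).
Context {A : KMT -> KMT} {k : R}.
Hypotheses (mA : measurable_fun setT A) (k_gt0 : 0 < k).
Hypothesis muA : forall E, measurable E -> mu (A @^-1` E) = (k%:E * mu E)%E.
Implicit Types f g : K -> R[i].

Lemma L2_scale f : L2 mu f -> L2 mu (fun x => f (A x)).
Proof.
move=> Lf; have mf := L2_cmeasurable Lf; case: Lf => mr mi fin; split.
- exact: (measurableT_comp mr mA).
- exact: (measurableT_comp mi mA).
- rewrite (integral_scale mA k_gt0 muA (f := fun x : KMT => (csq (f x))%:E)).
    by apply: lte_mul_pinfty => //; rewrite lee_fin ltW.
  by apply/measurable_EFinP; exact: measurable_csq.
Qed.

Lemma dist2_scale f g : L2 mu f -> L2 mu g ->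
  dist2 mu (fun x => f (A x)) (fun x => g (A x)) = (k%:E * dist2 mu f g)%E.
Proof.
move=> Lf Lg.
rewrite /dist2 (integral_scale mA k_gt0 muA (f := fun x : KMT => (csq (f x - g x))%:E))//.
by apply/measurable_EFinP; apply: measurable_csq; apply: L2_cmeasurable (L2B Lf Lg).
Qed.

Lemma inner_scale f g : L2 mu f -> L2 mu g ->
  inner mu (fun x => f (A x)) (fun x => g (A x)) = k%:C%C * inner mu f g.
Proof.
move=> /L2_cmeasurable mf /L2_cmeasurable mg; apply: part_inj => b.
rewrite part_mul !part_inner/= [X in _ + X](_ : _ = 0); last by case: b; rewrite ?oppr0 mul0r.
rewrite addr0.
apply: (Rintegral_scale mA k_gt0 muA (f := fun x : KMT => part b (f x * conjc (g x)))).
exact: cmeasurable_mulconj.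
Qed.

End ScalingSquareIntegrable.

(** * Refinement and biorthogonality *)

Section Refinement.
Context {R : realType} {K : fieldType} {p c : nat} {ab : K -> R} {pr : K}
  {zeta : 'I_c -> K}.
Hypothesis HK : local_field p ab pr zeta.
Context {mu : {measure set (KM ab) -> \bar R}}.
Hypothesis Hmu : haar mu.
Local Notation KMT := (KM ab).
Local Notation q := (p ^ c)%N.
Local Notation uu := (u p pr zeta).
Implicit Types (f g : K -> R[i]) (v : K).

Let q_gt0R : 0 < q%:R :> R.
Proof. by rewrite ltr0n ltnW// (residue_order_gt1 (lf_prime HK) (lf_c HK)). Qed.

Definition dilate f v : K -> R[i] := fun x => f (pr^-1 * x - v).

Let m_dilate v : measurable_fun setT (fun x : KMT => pr^-1 * x - v : KMT).
Proof. by apply: (measurable_affine HK); rewrite invr_neq0 ?(prime_elt_neq0 HK). Qed.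

Let m_translate v : measurable_fun setT (fun x : KMT => 1 * x - v : KMT).
Proof. by apply: (measurable_affine HK); rewrite oner_neq0. Qed.

Let mu_translate v (E : set KMT) : measurable E ->
  mu ((fun x : KMT => 1 * x - v : KMT) @^-1` E) = (1%:E * mu E)%E.
Proof. by move=> mE; rewrite mul1e (haar_translate Hmu). Qed.

Let translateE f v : translate f v = fun x => f (1 * x - v).
Proof. by apply/funext => x; rewrite mul1r. Qed.

Lemma L2_translate f v : L2 mu f -> L2 mu (translate f v).
Proof.
by rewrite translateE; exact: (L2_scale (m_translate v) ltr01 (@mu_translate v)).
Qed.

Lemma dist2_translate f g v : L2 mu f -> L2 mu g ->
  dist2 mu (translate f v) (translate g v) = dist2 mu f g.
Proof.
rewrite !translateE => Lf Lg.
by rewrite (dist2_scale (m_translate v) ltr01 (@mu_translate v))// mul1e.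
Qed.

Lemma L2_dilate f v : L2 mu f -> L2 mu (dilate f v).
Proof.
apply: (L2_scale (m_dilate v) _ (fun E => @haar_dilate _ _ _ _ _ _ _ HK _ Hmu v E)).
by rewrite invr_gt0.
Qed.

(** Substitute y = pr^-1 x - v: the second argument becomes pr^-1 x - w = y - (w - v). *)
Lemma inner_dilate f g v w : L2 mu f -> L2 mu g ->
  inner mu (dilate f v) (dilate g w) = (q%:R^-1)%:C%C * inner mu f (translate g (w - v)).
Proof.
move=> Lf Lg; have := L2_translate (w - v) Lg => Ltg.
rewrite -(inner_scale (m_dilate v) _ (fun E => @haar_dilate _ _ _ _ _ _ _ HK _ Hmu v E))//.
  congr (inner mu _ _); apply/funext => x.
  by rewrite /dilate /translate opprB addrA subrK.
by rewrite invr_gt0.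
Qed.

Lemma refine_partialE (a : nat -> R[i]) f N : refine_partial p pr zeta a f N =
  fun x => Complex (Num.sqrt (q%:R : R)) 0 * \sum_(k < N) a k * dilate f (uu k) x.
Proof. by []. Qed.

(** Passing through the dilation, a shift by v becomes a shift by pr^-1 v. *)
Lemma translate_refine_partial (a : nat -> R[i]) f N v :
  translate (refine_partial p pr zeta a f N) v =
  fun x => Complex (Num.sqrt (q%:R : R)) 0 *
    \sum_(k < N) a k * dilate f (pr^-1 * v + uu k) x.
Proof.
apply/funext => x; rewrite /translate refine_partialE; congr (_ * _).
by apply: eq_bigr => k _; rewrite /dilate mulrBr opprD addrA.
Qed.

Lemma L2_comb (w : R[i]) (a : nat -> R[i]) (F : nat -> K -> R[i]) N :
  (forall k, L2 mu (F k)) -> L2 mu (fun x => w * \sum_(k < N) a k * F k x).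
Proof.
move=> LF; apply: L2Z; apply: (L2_sum N (F := fun k x => a k * F k x)) => k.
exact: L2Z.
Qed.

Lemma inner_comb (w w' : R[i]) (a b : nat -> R[i]) (F G : nat -> K -> R[i]) N M :
  (forall k, L2 mu (F k)) -> (forall k, L2 mu (G k)) ->
  inner mu (fun x => w * \sum_(k < N) a k * F k x)
           (fun x => w' * \sum_(l < M) b l * G l x) =
  w * (conjc w' * \sum_(k < N) a k * \sum_(l < M) conjc (b l) * inner mu (F k) (G l)).
Proof.
move=> LF LG; have LaF k : L2 mu (fun x => a k * F k x) by exact: L2Z.
have LbG l : L2 mu (fun x => b l * G l x) by exact: L2Z.
have LsG : L2 mu (fun x => \sum_(l < M) b l * G l x).
  exact: (L2_sum M LbG).
rewrite innerZl; [|exact: (L2_sum N LaF)|exact: L2Z].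
rewrite innerZr//; last exact: (L2_sum N LaF).
rewrite (inner_suml N LaF)//; congr (_ * (_ * _)); apply: eq_bigr => k _.
rewrite innerZl//; congr (_ * _).
by rewrite (inner_sumr M LbG)//; apply: eq_bigr => l _; rewrite innerZr.
Qed.

Lemma inner_refine_partialE (a ta : nat -> R[i]) f ft N v : L2 mu f -> L2 mu ft ->
  let sq := Complex (Num.sqrt (q%:R : R)) 0 in
  inner mu (refine_partial p pr zeta a f N)
           (translate (refine_partial p pr zeta ta ft N) v) =
  sq * (conjc sq * \sum_(k < N) a k * \sum_(l < N) conjc (ta l) *
    ((q%:R^-1)%:C%C * inner mu f (translate ft (pr^-1 * v + uu l - uu k)))).
Proof.
move=> Lf Lft sq; rewrite translate_refine_partial refine_partialE.
rewrite (inner_comb sq sq a ta N N (F := fun k => dilate f (uu k))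
  (G := fun l => dilate ft (pr^-1 * v + uu l))); [|by move=> k; exact: L2_dilate..].
congr (_ * (_ * _)); apply: eq_bigr => k _; congr (_ * _).
by apply: eq_bigr => l _; rewrite inner_dilate.
Qed.

Lemma inner_refine_partial (a ta : nat -> R[i]) f ft g gt N m :
  L2 mu f -> L2 mu ft -> L2 mu g -> L2 mu gt ->
  (forall k, inner mu f (translate ft (uu k)) = inner mu g (translate gt (uu k))) ->
  inner mu (refine_partial p pr zeta a f N)
           (translate (refine_partial p pr zeta ta ft N) (uu m)) =
  inner mu (refine_partial p pr zeta a g N)
           (translate (refine_partial p pr zeta ta gt N) (uu m)).
Proof.
move=> Lf Lft Lg Lgt fg.
rewrite (inner_refine_partialE a ta N _ Lf Lft) (inner_refine_partialE a ta N _ Lg Lgt).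
congr (_ * (_ * _)); apply: eq_bigr => k _; congr (_ * _).
apply: eq_bigr => l _; congr (_ * (_ * _)).
(* The shift pr^-1 u(m) + u(l) - u(k) is rewritten piece by piece into a single u(n), where the
   hypothesis [fg] applies. *)
have [i ->] := u_dilate pr zeta (lf_prime HK) (lf_c HK) m.
have [j ->] := u_add pr zeta (lf_prime HK) (lf_char HK) (lf_c HK) i l.
have [k' ->] := u_opp pr zeta (lf_prime HK) (lf_char HK) (lf_c HK) k.
by have [n ->] := u_add pr zeta (lf_prime HK) (lf_char HK) (lf_c HK) j k'.
Qed.

Lemma L2_refine_partial (a : nat -> R[i]) f N : L2 mu f ->
  L2 mu (refine_partial p pr zeta a f N).
Proof.
move=> Lf; rewrite refine_partialE.
apply: (L2_comb _ a N (F := fun k => dilate f (uu k))) => k; exact: L2_dilate.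
Qed.

Lemma L2_lim_translate (s : nat -> K -> R[i]) f v :
  (forall n, L2 mu (s n)) -> L2 mu f -> L2_lim mu s f ->
  L2_lim mu (fun n => translate (s n) v) (translate f v).
Proof.
move=> Ls Lf; rewrite /L2_lim.
rewrite [X in _ -> X @ _ --> _](_ : _ = fun n => dist2 mu (s n) f) //.
by apply/funext => n; exact: dist2_translate.
Qed.

Lemma inner_refine_cvg b (a ta : nat -> R[i]) f ft F Ft v :
  L2 mu f -> L2 mu ft -> L2 mu F -> L2 mu Ft ->
  refinement mu p pr zeta a f F -> refinement mu p pr zeta ta ft Ft ->
  part b (inner mu (refine_partial p pr zeta a f N)
    (translate (refine_partial p pr zeta ta ft N) v)) @[N --> \oo] -->
  part b (inner mu F (translate Ft v)).
Proof.
move=> Lf Lft LF LFt rF rFt.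
have Lr N := L2_refine_partial a N Lf; have Lrt N := L2_refine_partial ta N Lft.
have Ltr N := L2_translate v (Lrt N).
apply: inner_cvg => //; first exact: L2_translate.
exact: L2_lim_translate.
Qed.

(** The pairings of the partial sums agree term by term for the two pairs, and limits in R are
    unique. *)
Lemma inner_refinement (a ta : nat -> R[i]) f ft g gt F Ft G Gt m :
  L2 mu f -> L2 mu ft -> L2 mu g -> L2 mu gt ->
  L2 mu F -> L2 mu Ft -> L2 mu G -> L2 mu Gt ->
  refinement mu p pr zeta a f F -> refinement mu p pr zeta ta ft Ft ->
  refinement mu p pr zeta a g G -> refinement mu p pr zeta ta gt Gt ->
  (forall k, inner mu f (translate ft (uu k)) = inner mu g (translate gt (uu k))) ->
  inner mu F (translate Ft (uu m)) = inner mu G (translate Gt (uu m)).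
Proof.
move=> Lf Lft Lg Lgt LF LFt LG LGt rF rFt rG rGt fg; apply: part_inj => b.
have cvgF := inner_refine_cvg (b := b) (v := uu m) Lf Lft LF LFt rF rFt.
have cvgG := inner_refine_cvg (b := b) (v := uu m) Lg Lgt LG LGt rG rGt.
apply: (cvg_unique (@Rhausdorff R) cvgF).
rewrite [X in [set x | X @ _ --> x]](_ : _ = fun N => part b (inner mu
  (refine_partial p pr zeta a g N) (translate (refine_partial p pr zeta ta gt N) (uu m)))) //.
by apply/funext => N; rewrite (inner_refine_partial a ta N m Lf Lft Lg Lgt fg).
Qed.

End Refinement.

(** * Biorthogonality of the packets, by strong induction on n *)

Theorem theorem3p2
  (R : realType) (K : fieldType) (p c : nat) (ab : K -> R) (pr : K)
  (zeta : 'I_c -> K)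
  (HK : local_field p ab pr zeta)
  (mu : {measure set (KM ab) -> \bar R}) (Hmu : haar mu)
  (a ta : nat -> nat -> R[i])
  (Ha : forall s, (s < p ^ c)%N -> l2seq (a s))
  (Hta : forall s, (s < p ^ c)%N -> l2seq (ta s))
  (phi phit : K -> R[i]) (psi psit : nat -> K -> R[i])
  (Hphi : L2 mu phi) (Hphit : L2 mu phit)
  (Hpsi : forall l, (0 < l < p ^ c)%N -> L2 mu (psi l))
  (Hpsit : forall l, (0 < l < p ^ c)%N -> L2 mu (psit l))
  (Hrphi : refinement mu p pr zeta (a 0%N) phi phi)
  (Hrphit : refinement mu p pr zeta (ta 0%N) phit phit)
  (Hrpsi : forall l, (0 < l < p ^ c)%N -> refinement mu p pr zeta (a l) phi (psi l))
  (Hrpsit : forall l, (0 < l < p ^ c)%N -> refinement mu p pr zeta (ta l) phit (psit l))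
  (V : int -> (K -> R[i]) -> Prop) (HV : MRA mu p pr zeta V phi)
  (W : (K -> R[i]) -> Prop) (HW : closed_subspace mu W)
  (HVW0 : forall f, V 0 f -> W f -> dist2 mu f (@zerof R K) = 0%E)
  (HVW1 : forall f, V 1 f <->
      (L2 mu f /\ exists g h, [/\ V 0 g, W h & dist2 mu f (fun x => g x + h x) = 0%E]))
  (HWriesz : riesz_basis mu
      (fun i : 'I_(p ^ c).-1 * nat => translate (psi i.1.+1) (u p pr zeta i.2)) W)
  (Hbio1 : forall k, inner mu phi (translate phit (u p pr zeta k)) = (k == 0%N)%:R)
  (Hbio2 : forall k l, (0 < l < p ^ c)%N ->
      inner mu phi (translate (psit l) (u p pr zeta k)) = 0)
  (Hbio3 : forall k l, (0 < l < p ^ c)%N ->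
      inner mu phit (translate (psi l) (u p pr zeta k)) = 0)
  (Hbio4 : forall k l l', (0 < l < p ^ c)%N -> (0 < l' < p ^ c)%N ->
      inner mu (psi l) (translate (psit l') (u p pr zeta k))
        = ((l == l') && (k == 0%N))%:R)
  (om omt : nat -> K -> R[i])
  (Hom0 : om 0%N = phi) (Homt0 : omt 0%N = phit)
  (Hom : forall n, L2 mu (om n) /\
      refinement mu p pr zeta (a (n %% p ^ c)%N) (om (n %/ p ^ c)%N) (om n))
  (Homt : forall n, L2 mu (omt n) /\
      refinement mu p pr zeta (ta (n %% p ^ c)%N) (omt (n %/ p ^ c)%N) (omt n)) :
  forall n k : nat,
    inner mu (om n) (translate (omt n) (u p pr zeta k)) = (k == 0%N)%:R.
Proof.
have q_gt1 := residue_order_gt1 (lf_prime HK) (lf_c HK).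
(* The index 0 is its own quotient by q, so it starts the induction; for N > 0 and q > 1 the
   quotient r is smaller than N. *)
elim/ltn_ind => -[_ k|n IH k]; first by rewrite Hom0 Homt0.
set N := n.+1; pose r := (N %/ p ^ c)%N; pose s := (N %% p ^ c)%N.
have rN : (r < N)%N by exact: ltn_Pdiv.
have sq : (s < p ^ c)%N by rewrite ltn_pmod// ltnW.
have [Lr _] := Hom r; have [Ltr _] := Homt r.
have [LN rfN] := Hom N; have [LtN rftN] := Homt N.
have same i : inner mu (om r) (translate (omt r) (u p pr zeta i)) =
    inner mu phi (translate phit (u p pr zeta i)) by rewrite IH// Hbio1.
(* For s = 0 the pair to compare with is (phi, phit), refined from itself; otherwise it is (psi_s,
   psit_s), refined from (phi, phit) with the same coefficients. *)
have [s0|s_gt0] := posnP s.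
  rewrite -(Hbio1 k); move: rfN rftN; rewrite -/s s0 => rfN rftN.
  exact: (inner_refinement HK Hmu k Lr Ltr Hphi Hphit LN LtN Hphi Hphit
    rfN rftN Hrphi Hrphit same).
have sb : (0 < s < p ^ c)%N by rewrite s_gt0.
rewrite (inner_refinement HK Hmu k Lr Ltr Hphi Hphit LN LtN (Hpsi _ sb) (Hpsit _ sb)
  rfN rftN (Hrpsi _ sb) (Hrpsit _ sb) same).
by rewrite Hbio4// eqxx.
Qed.
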